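(* Let $\varphi$ be a formula of LTL$(\mathsf{F}_{\mathsf{s}},\mathsf{G}_{\mathsf{s}})$ in positive normal form, let $n$ be the length of $\varphi$, and let $\mathcal{A}_\varphi$, $\mathcal{G}$, $\mathcal{D}$ be the automata produced from $\varphi$ by the three-step translation described in the context (formula to MMAA $\mathcal{A}_\varphi$, MMAA to TGDRA $\mathcal{G}$, TGDRA to DRA $\mathcal{D}$). Then: (i) the MMAA $\mathcal{A}_\varphi$ has at most $n$ states; (ii) the TGDRA $\mathcal{G}$ has at most $2^{2^n}$ states and at most $2^n$ generalized Rabin pairs; (iii) passing from $\mathcal{G}$ to $\mathcal{D}$ multiplies the state space by at most $|Z|+2$ for each generalized Rabin pair $\mathcal{GR}_Z$ of $\mathcal{G}$, where $|Z|\le n$; altogether, the number $|Q_{\mathcal D}|$ of states of the DRA $\mathcal{D}$ satisfies $$|Q_{\mathcal D}|\le 2^{2^n}\cdot(n+2)^{2^n}=2^{2^n}\cdot 2^{2^n\cdot\log_2(n+2)}=2^{2^n}\cdot 2^{2^{\,n+\log_2\log_2(n+2)}}\in 2^{\mathcal{O}(2^{\,n+\log\log n})}.$$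
   Context: Logic. LTL formulae are interpreted on infinite words $u=u_0u_1\ldots$ over an alphabet $2^{AP'}$ ($AP'$ a finite set of atomic propositions) as usual; $u_{i..}=u_iu_{i+1}\ldots$. Here $u\models\mathsf{F}\psi$ (resp. $\mathsf{G}\psi$) iff $u_{i..}\models\psi$ for some (resp. all) $i\ge0$, and $u\models\mathsf{F}_{\mathsf{s}}\psi$ (resp. $\mathsf{G}_{\mathsf{s}}\psi$) iff $u_{i..}\models\psi$ for some (resp. all) $i\ge1$. LTL$(\mathsf{F}_{\mathsf{s}},\mathsf{G}_{\mathsf{s}})$ is the set of LTL formulae built with the temporal operators $\mathsf{F},\mathsf{G},\mathsf{F}_{\mathsf{s}},\mathsf{G}_{\mathsf{s}}$ only (and true, written $tt$, atomic propositions, $\neg,\vee,\wedge$). A formula is in positive normal form if no operator occurs in the scope of a negation. A formula is temporal if its topmost operator is neither conjunction nor disjunction ($a$ and $\neg a$ are temporal). $\mathsf{G}\psi$ and $\mathsf{F}\psi$ are considered to be subformulae of $\mathsf{G}_{\mathsf{s}}\psi$ and $\mathsf{F}_{\mathsf{s}}\psi$ respectively (as $\mathsf{G}_{\mathsf{s}}\psi\equiv\mathsf{X}\mathsf{G}\psi$, $\mathsf{F}_{\mathsf{s}}\psi\equiv\mathsf{X}\mathsf{F}\psi$, with $\mathsf{X}$ the next operator). $AP(\varphi)$ is the set of atomic propositions occurring in $\varphi$. Automata. A very weak alternating co-Büchi automaton (VWAA) is a tuple $(S,\Sigma,\delta,I,F)$ with a finite set $S$ of states (subsets of $S$ are called configurations),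 $\delta\subseteq S\times\Sigma\times2^S$, a non-empty set $I\subseteq2^S$ of initial configurations, $F\subseteq S$, and such that for some partial order on $S$, every $(s,\alpha,c)\in\delta$ has all states of $c$ lower than or equal to $s$. A transition $(s,\alpha,c)$ is looping if $s\in c$ and a selfloop if $c=\{s\}$. A multitransition $T$ with label $\alpha$ is a set of transitions labelled $\alpha$ with pairwise different source states; $\mathrm{dom}(T)$ is the set of source states and $\mathrm{range}(T)$ the union of the target configurations; $\Delta=\{(\mathrm{dom}(T),\alpha,\mathrm{range}(T))\mid T\text{ a multitransition with label }\alpha\}$. A run over $w=w_0w_1\ldots$ is a sequence $T_0T_1\ldots$ of multitransitions with $\mathrm{dom}(T_0)\in I$, $T_i$ labelled by $w_i$ and $\mathrm{range}(T_i)=\mathrm{dom}(T_{i+1})$; it is accepting if it has no suffix in which, for some $f\in F$, each multitransition contains a looping transition from $f$. A may/must alternating automaton (MMAA) is a VWAA in which every state is a may-state (it has a selfloop for each $\alpha\in\Sigma$), a must-state (all its transitions are looping), or a loopless state (no looping transitions and no predecessors); $F$ is taken to be the set of may-states. A semiautomaton $(S,\Sigma,\delta,s_I)$ has finite state set $S$, initial state $s_I$, and deterministic $\delta\subseteq S\times\Sigma\times S$ (at most one successor per state and letter). A deterministic Rabin automaton (DRA) is a semiautomaton with a finite set of pairs $(K,L)$, $K,L\subseteq S$; a run is accepting if, for some pair, it visits $K$ only finitely often and $L$ infinitely often. A transition-based generalized deterministic Rabin automaton (TGDRA) is a semiautomaton with a finite set of generalized Rabin pairs $(K,\{L^j\}_{j\in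 J})$, $K,L^j\subseteq\delta$; a run is accepting if, for some pair, it uses transitions of $K$ only finitely often and transitions of each $L^j$ infinitely often. Step 1 (formula to MMAA). $\mathcal{A}_\varphi=(S,\Sigma,\delta,I,F)$, where $S$ is the set of temporal subformulae of $\varphi$, $\Sigma=2^{AP(\varphi)}$, $F$ is the set of formulae of the form $\mathsf{F}\psi$ in $S$, and, writing $c\in\delta(s,\alpha)$ for $(s,\alpha,c)\in\delta$: $\delta(tt,\alpha)=\{\emptyset\}$; $\delta(\neg tt,\alpha)=\emptyset$; $\delta(a,\alpha)=\{\emptyset\}$ if $a\in\alpha$ and $\emptyset$ otherwise; $\delta(\neg a,\alpha)=\{\emptyset\}$ if $a\notin\alpha$ and $\emptyset$ otherwise; $\delta(\mathsf{G}_{\mathsf{s}}\psi,\alpha)=\{\{\mathsf{G}\psi\}\}$; $\delta(\mathsf{F}_{\mathsf{s}}\psi,\alpha)=\{\{\mathsf{F}\psi\}\}$; $\delta(\mathsf{G}\psi,\alpha)=\{c\cup\{\mathsf{G}\psi\}\mid c\in\overline\delta(\psi,\alpha)\}$; $\delta(\mathsf{F}\psi,\alpha)=\{\{\mathsf{F}\psi\}\}\cup\overline\delta(\psi,\alpha)$; where $\overline\delta(\psi,\alpha)=\delta(\psi,\alpha)$ for temporal $\psi$, $\overline\delta(\psi_1\vee\psi_2,\alpha)=\overline\delta(\psi_1,\alpha)\cup\overline\delta(\psi_2,\alpha)$, $\overline\delta(\psi_1\wedge\psi_2,\alpha)=\{c_1\cup c_2\mid c_i\in\overline\delta(\psi_i,\alpha)\}$.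 Further $I=\overline\varphi$, where $\overline\psi=\{\{\psi\}\}$ for temporal $\psi$, $\overline{\psi_1\vee\psi_2}=\overline{\psi_1}\cup\overline{\psi_2}$, $\overline{\psi_1\wedge\psi_2}=\{O_1\cup O_2\mid O_i\in\overline{\psi_i}\}$. This is an MMAA equivalent to $\varphi$. Step 2 (MMAA to TGDRA). For $\mathcal{A}_\varphi=(S,\Sigma,\delta,I,F)$ with multitransition relation $\Delta$, the semiautomaton of $\mathcal{G}$ is $(M,\Sigma,\delta_{\mathcal T},m_I)$ with $m_I=I$, $(m_1,\alpha,m_2)\in\delta_{\mathcal T}$ iff $m_2=\bigcup_{c\in m_1}\{c'\mid(c,\alpha,c')\in\Delta\}$, and $M\subseteq2^{2^S}$ the set of states reachable from $m_I$. For $Z\subseteq S$ let $\mathrm{must}(Z)$ be the set of must-states in $Z$, $AC_Z=\{c\subseteq Z\mid\mathrm{must}(c)=\mathrm{must}(Z)\}$, $AT_Z=\{(m_1,\alpha,m_2)\in\delta_{\mathcal T}\mid\exists c_1\in AC_Z,\ c_2\in m_2\cap AC_Z:(c_1,\alpha,c_2)\in\Delta\}$, and for $f\in F\cap Z$ let $AT_Z^f=\{(m_1,\alpha,m_2)\in AT_Z\mid\exists(f,\alpha,c)\in\delta: f\notin c,\ c\subseteq Z\}$. The acceptance condition of $\mathcal{G}$ is $\{\mathcal{GR}_Z\mid Z\subseteq S\}$ with $\mathcal{GR}_Z=(\delta_{\mathcal T}\smallsetminus AT_Z,\{AT_Z^f\}_{f\in F\cap Z})$. $\mathcal{G}$ is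 equivalent to $\mathcal{A}_\varphi$. Step 3 (TGDRA to DRA). Write the generalized Rabin pairs of $\mathcal{G}$ as $(K_i,\{L_i^j\}_{1\le j\le h_i})$, $1\le i\le k$. The DRA $\mathcal{D}$ has state set $Q_{\mathcal D}=M\times\{0,\ldots,h_1+1\}\times\cdots\times\{0,\ldots,h_k+1\}$, initial state $(m_I,1,\ldots,1)$, and a transition from $(m,l_1,\ldots,l_k)$ to $(m',l_1',\ldots,l_k')$ labelled $\alpha$ iff $r=(m,\alpha,m')\in\delta_{\mathcal T}$ and for each $i$: $l_i'=0$ if $r\in K_i$; $l_i'=\max\{l_i\le l\le h_i+1\mid\forall\, l_i\le j<l: r\in L_i^j\}$ if $r\notin K_i$ and $1\le l_i\le h_i$; $l_i'=\max\{1\le l\le h_i+1\mid\forall\,1\le j<l: r\in L_i^j\}$ if $r\notin K_i$ and $l_i\in\{0,h_i+1\}$. Its Rabin pairs are $(K_i',L_i')$, $1\le i\le k$, with $K_i'$ the states having $l_i=0$ and $L_i'$ the states having $l_i=h_i+1$. $\mathcal{D}$ is equivalent to $\mathcal{G}$.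
   Formalization: The length n counts each strict operator F_s, G_s as two symbols (for XF, XG); with one symbol each, claim (i) fails, e.g. G_s a has length 2 but its MMAA has the three states G_s a, G a, a. *)

(* Defs.v *)
From HB Require Import structures.
From mathcomp Require Import all_boot.

Set Implicit Arguments.
Unset Strict Implicit.
Unset Printing Implicit Defensive.

Inductive ltl (AP : Type) : Type :=
| LTrue
| LAtom of AP
| LNot of ltl AP
| LOr of ltl AP & ltl AP
| LAnd of ltl AP & ltl AP
| LF of ltl AP
| LG of ltl AP
| LFs of ltl AP
| LGs of ltl AP.

Arguments LTrue {AP}.

Section LtlChoice.
Variable AP : choiceType.

Fixpoint ltl_encode (phi : ltl AP) : GenTree.tree AP :=
  match phi with
  | LTrue => GenTree.Node 0 [::]
  | LAtom a => GenTree.Leaf a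
  | LNot p => GenTree.Node 1 [:: ltl_encode p]
  | LOr p q => GenTree.Node 2 [:: ltl_encode p; ltl_encode q]
  | LAnd p q => GenTree.Node 3 [:: ltl_encode p; ltl_encode q]
  | LF p => GenTree.Node 4 [:: ltl_encode p]
  | LG p => GenTree.Node 5 [:: ltl_encode p]
  | LFs p => GenTree.Node 6 [:: ltl_encode p]
  | LGs p => GenTree.Node 7 [:: ltl_encode p]
  end.

Fixpoint ltl_decode (t : GenTree.tree AP) : ltl AP :=
  match t with
  | GenTree.Leaf a => LAtom a
  | GenTree.Node 1 [:: p] => LNot (ltl_decode p)
  | GenTree.Node 2 [:: p; q] => LOr (ltl_decode p) (ltl_decode q)
  | GenTree.Node 3 [:: p; q] => LAnd (ltl_decode p) (ltl_decode q)
  | GenTree.Node 4 [:: p] => LF (ltl_decode p)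
  | GenTree.Node 5 [:: p] => LG (ltl_decode p)
  | GenTree.Node 6 [:: p] => LFs (ltl_decode p)
  | GenTree.Node 7 [:: p] => LGs (ltl_decode p)
  | _ => LTrue
  end.

Lemma ltl_encodeK : cancel ltl_encode ltl_decode.
Proof. by elim=> //= [p->|p-> q->|p-> q->|p->|p->|p->|p->]. Qed.

HB.instance Definition _ := Choice.copy (ltl AP) (can_type ltl_encodeK).

End LtlChoice.

Section Formulae.
Variable AP : choiceType.
Implicit Types phi psi : ltl AP.

(* Number of symbols, where Fs and Gs stand for X F and X G and so count for
   two symbols.  This matches [subf] below, where G psi is a subformula of
   Gs psi: with a one-symbol Gs the formula (Gs a) would have length 2 but the
   three temporal subformulae Gs a, G a and a. *)
Fixpoint ltl_length phi : nat :=
  match phi with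
  | LTrue | LAtom _ => 1
  | LNot p | LF p | LG p => (ltl_length p).+1
  | LOr p q | LAnd p q => (ltl_length p + ltl_length q).+1
  | LFs p | LGs p => (ltl_length p).+2
  end.

Fixpoint pnf phi : bool :=
  match phi with
  | LTrue | LAtom _ => true
  | LNot LTrue | LNot (LAtom _) => true
  | LNot _ => false
  | LF p | LG p | LFs p | LGs p => pnf p
  | LOr p q | LAnd p q => pnf p && pnf q
  end.

Definition temporal phi : bool :=
  match phi with LOr _ _ | LAnd _ _ => false | _ => true end.

Fixpoint subf phi : seq (ltl AP) :=
  phi :: match phi with
         | LTrue | LAtom _ => [::]
         | LNot p | LF p | LG p => subf p
         | LOr p q | LAnd p q => subf p ++ subf q
         | LFs p => LF p :: subf p
         | LGs p => LG p :: subf p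
         end.

Fixpoint atoms phi : seq AP :=
  match phi with
  | LTrue => [::]
  | LAtom a => [:: a]
  | LNot p | LF p | LG p | LFs p | LGs p => atoms p
  | LOr p q | LAnd p q => atoms p ++ atoms q
  end.

Definition is_F phi : bool := if phi is LF _ then true else false.
Definition is_G phi : bool := if phi is LG _ then true else false.

(* 2^AP(phi) *)
Definition letter phi : finType := {set seq_sub (atoms phi)}.

Definition tsub phi : finType := seq_sub [seq psi <- subf phi | temporal psi].

End Formulae.

Section AlternatingAutomata.
Variable Sigma : finType.

Record vwaa : Type := Vwaa {
  vstate : finType;
  vtrans : {set vstate * Sigma * {set vstate}};
  vinit : {set {set vstate}};
  vacc : {set vstate};
  vinit_neq0 : vinit != set0;
  vtrans_weak : exists le : rel vstate,
    [/\ reflexive le, antisymmetric le, transitive le &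
      forall s a c, (s, a, c) \in vtrans -> forall t, t \in c -> le t s]
}.

Section States.
Variable A : vwaa.
Implicit Types (s : vstate A) (t : vstate A * Sigma * {set vstate A}).

Definition looping t : bool := t.1.1 \in t.2.

Definition may_state s : bool :=
  [forall a : Sigma, (s, a, [set s]) \in vtrans A].

Definition must_state s : bool :=
  [forall t in vtrans A, (t.1.1 == s) ==> looping t].

Definition loopless_state s : bool :=
  [forall t in vtrans A, (t.1.1 == s) ==> ~~ looping t]
  && [forall t in vtrans A, s \notin t.2].

Definition multitrans (a : Sigma) (T : {set vstate A * Sigma * {set vstate A}})
    : bool :=
  [&& T \subset vtrans A,
      [forall t in T, t.1.2 == a] &
      [forall t in T, forall u in T, (t.1.1 == u.1.1) ==> (t == u)]].

Definition mdom (T : {set vstate A * Sigma * {set vstate A}})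
    : {set vstate A} := [set t.1.1 | t in T].

Definition mrange (T : {set vstate A * Sigma * {set vstate A}})
    : {set vstate A} := \bigcup_(t in T) t.2.

Definition Delta : {set {set vstate A} * Sigma * {set vstate A}} :=
  [set x | [exists T, [&& multitrans x.1.2 T, mdom T == x.1.1
                        & mrange T == x.2]]].

End States.

(* The accepting set stays the one carried by the automaton: a state such as
   G tt meets the definition of a may-state, but is not accepting in the
   automaton of a formula. *)
Record mmaa : Type := Mmaa {
  mmaa_vwaa :> vwaa;
  mmaaP : forall s : vstate mmaa_vwaa,
    [|| may_state s, must_state s | loopless_state s]
}.

End AlternatingAutomata.

Section DeterministicAutomata.
Variable Sigma : finType.

Record semiaut : Type := Semiaut {
  sstate : finType;
  sinit : sstate;
  strans : {set sstate * Sigma * sstate};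
  strans_det : forall q a q1 q2,
    (q, a, q1) \in strans -> (q, a, q2) \in strans -> q1 = q2
}.

Record dra : Type := Dra {
  dra_semiaut :> semiaut;
  dra_acc : {set {set sstate dra_semiaut} * {set sstate dra_semiaut}}
}.

(* A pair (K, {L^j}_{j in J}) of sets of elements of T: the family is a partial
   function on X whose domain is J. *)
Definition grpair (T X : finType) : finType :=
  ({set T} * {ffun X -> option {set T}})%type.

Section GrPair.
Variables T X : finType.
Implicit Type p : grpair T X.

Definition gr_K p : {set T} := p.1.
Definition gr_dom p : {set X} := [set x | isSome (p.2 x)].
Definition gr_L p (x : X) : {set T} := odflt set0 (p.2 x).
Definition gr_size p : nat := #|gr_dom p|.

End GrPair.

Record tgdra : Type := Tgdra {
  tgdra_semiaut :> semiaut;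
  tgdra_idx : finType;
  tgdra_acc :
    {set grpair (sstate tgdra_semiaut * Sigma * sstate tgdra_semiaut)%type
                tgdra_idx};
  tgdra_acc_sub : forall p, p \in tgdra_acc ->
    gr_K p \subset strans tgdra_semiaut
    /\ forall x, x \in gr_dom p -> gr_L p x \subset strans tgdra_semiaut
}.

End DeterministicAutomata.

Definition tgdra_trans (Sigma : finType) (G : tgdra Sigma) : finType :=
  (sstate G * Sigma * sstate G)%type.

Section FormulaToMmaa.
Variables (AP : choiceType) (phi : ltl AP).
Implicit Types (psi : ltl AP) (alpha : letter phi).

(* The configuration {psi}, for a temporal subformula psi of phi (see
   [single_val]). *)
Definition single psi : {set tsub phi} := [set s | val s == psi].

Definition holds_atom (a : AP) alpha : bool :=
  [exists x in alpha, val x == a].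

(* On temporal psi this is delta(psi, alpha), which coincides there with
   the extension of delta to all formulae; the clause for other negations is
   not used for formulae in positive normal form. *)
Fixpoint delta_bar psi alpha : {set {set tsub phi}} :=
  match psi with
  | LTrue => [set set0]
  | LNot LTrue => set0
  | LAtom a => if holds_atom a alpha then [set set0] else set0
  | LNot (LAtom a) => if holds_atom a alpha then set0 else [set set0]
  | LNot _ => set0
  | LGs p => [set single (LG p)]
  | LFs p => [set single (LF p)]
  | LG p => [set c :|: single (LG p) | c in delta_bar p alpha]
  | LF p => single (LF p) |: delta_bar p alpha
  | LOr p q => delta_bar p alpha :|: delta_bar q alpha
  | LAnd p q => [set c1 :|: c2 | c1 in delta_bar p alpha,
                                 c2 in delta_bar q alpha]
  end.

Fixpoint init_bar psi : {set {set tsub phi}} :=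
  match psi with
  | LOr p q => init_bar p :|: init_bar q
  | LAnd p q => [set o1 :|: o2 | o1 in init_bar p, o2 in init_bar q]
  | _ => [set single psi]
  end.

Definition fm_trans : {set tsub phi * letter phi * {set tsub phi}} :=
  [set t | t.2 \in delta_bar (val t.1.1) t.1.2].

Definition fm_acc : {set tsub phi} := [set s | is_F (val s)].

Lemma single_val (s : tsub phi) : single (val s) = [set s].
Proof. by apply/setP=> t; rewrite !inE val_eqE. Qed.

Lemma in_delta_bar psi alpha c (t : tsub phi) :
  c \in delta_bar psi alpha -> t \in c ->
  (is_F (val t) || is_G (val t)) /\
  (val t = psi \/ ltl_length (val t) < ltl_length psi).
Proof.
elim: psi c => [|a|p IH|p IHp q IHq|p IHp q IHq|p IH|p IH|p IH|p IH] c /=.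
- by rewrite inE => /eqP->; rewrite inE.
- by case: ifP => _; rewrite inE // => /eqP->; rewrite inE.
- case: p {IH} => [|a|?|? ?|? ?|?|?|?|?]; rewrite ?inE //.
  by case: ifP => _; rewrite inE // => /eqP->; rewrite inE.
- rewrite inE => /orP[/IHp|/IHq] H /H[-> [->|lt]]; split=> //; right.
  + by rewrite ltnS leq_addr.
  + by rewrite (leq_trans lt)// ltnW// ltnS leq_addr.
  + by rewrite ltnS leq_addl.
  + by rewrite (leq_trans lt)// ltnW// ltnS leq_addl.
- move=> /imset2P[c1 c2 /IHp H1 /IHq H2 ->]; rewrite inE.
  move=> /orP[/H1|/H2][-> [->|lt]]; split=> //; right.
  + by rewrite ltnS leq_addr.
  + by rewrite (leq_trans lt)// ltnW// ltnS leq_addr.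
  + by rewrite ltnS leq_addl.
  + by rewrite (leq_trans lt)// ltnW// ltnS leq_addl.
- rewrite in_setU1 => /orP[/eqP->|/IH H]; first by rewrite inE => /eqP->; split=> //; left.
  by move=> /H[-> [->|lt]]; split=> //; right; [exact: ltnSn | exact: leqW].
- move=> /imsetP[c1 /IH H ->]; rewrite !inE => /orP[/H|/eqP->]; last by split=> //; left.
  by move=> [-> [->|lt]]; split=> //; right; [exact: ltnSn | exact: leqW].
- by rewrite inE => /eqP->; rewrite inE => /eqP->; split=> //; right.
- by rewrite inE => /eqP->; rewrite inE => /eqP->; split=> //; right.
Qed.

Lemma fm_init_neq0 : init_bar phi != set0.
Proof.
suff H psi : init_bar psi != set0 by exact: H.
elim: psi => [|a|p _|p /set0Pn[c cp] q _|p /set0Pn[c cp] q /set0Pn[d dq]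
             |p _|p _|p _|p _] /=; try by apply/set0Pn; eexists; exact: set11.
- by apply/set0Pn; exists c; rewrite inE cp.
- by apply/set0Pn; exists (c :|: d); apply: imset2_f.
Qed.

Lemma fm_trans_weak : exists le : rel (tsub phi),
  [/\ reflexive le, antisymmetric le, transitive le &
    forall s a c, (s, a, c) \in fm_trans -> forall t, t \in c -> le t s].
Proof.
exists (fun t s => (t == s) || (ltl_length (val t) < ltl_length (val s))).
split=> [s|s t|s t u|s a c].
- by rewrite eqxx.
- case: eqVneq => //= nst /andP[lt1 lt2].
  by have := ltn_trans lt1 lt2; rewrite ltnn.
- case/orP=> [/eqP->//|lt1] /orP[/eqP<-|lt2]; first by rewrite lt1 orbT.
  by rewrite (ltn_trans lt1 lt2) orbT.
- rewrite inE => /= sc t tc; case: (in_delta_bar sc tc) => _ [/val_inj->|->].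
    by rewrite eqxx.
  by rewrite orbT.
Qed.

Definition fm_vwaa : vwaa (letter phi) :=
  Vwaa fm_acc fm_init_neq0 fm_trans_weak.

Lemma fm_mmaaP (s : vstate fm_vwaa) :
  [|| may_state s, must_state s | loopless_state s].
Proof.
have [sF|nF] := boolP (is_F (val s)).
  apply/orP; left; apply/forallP => a; rewrite inE -single_val.
  have FF psi : is_F psi -> single psi \in delta_bar psi a.
    by case: psi => //= p _; exact: setU11.
  exact: FF.
have [sG|nG] := boolP (is_G (val s)).
  apply/orP; right; apply/orP; left; apply/forall_inP => -[[u a] c] uc.
  apply/implyP => /eqP /= us; rewrite {u}us in uc *; rewrite inE /= in uc.
  have GG psi : is_G psi -> c \in delta_bar psi a -> single psi \subset c.
    by case: psi => // p _ /imsetP[c1 _ ->]; exact: subsetUr.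
  by rewrite /looping /= -sub1set -single_val; exact: GG.
have nos t : t \in vtrans fm_vwaa -> s \notin t.2.
  case: t => [[u a] c]; rewrite inE => /= uc; apply/negP => sc.
  by case: (in_delta_bar uc sc); rewrite (negPf nF) (negPf nG).
apply/orP; right; apply/orP; right; apply/andP; split.
  by apply/forall_inP => t /nos st; apply/implyP => /eqP ts; rewrite /looping ts.
by apply/forall_inP.
Qed.

Definition formula_mmaa : mmaa (letter phi) := Mmaa fm_mmaaP.

End FormulaToMmaa.

Section MmaaToTgdra.
Variables (Sigma : finType) (A : mmaa Sigma).
Local Notation S := (vstate A).

Definition msucc (m : {set {set S}}) (a : Sigma) : {set {set S}} :=
  \bigcup_(c in m) [set c' | (c, a, c') \in Delta A].

Definition reachable (m : {set {set S}}) : bool :=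
  connect (fun m1 m2 => [exists a, m2 == msucc m1 a]) (vinit A) m.

Definition mstate : finType := {m : {set {set S}} | reachable m}.

Definition mstate_init : mstate := Sub (vinit A) (connect0 _ _).

Definition mtrans : {set mstate * Sigma * mstate} :=
  [set t | val t.2 == msucc (val t.1.1) t.1.2].

Lemma mtrans_det m a m1 m2 :
  (m, a, m1) \in mtrans -> (m, a, m2) \in mtrans -> m1 = m2.
Proof. by rewrite !inE => /eqP e1 /eqP e2; apply: val_inj; rewrite e1 e2. Qed.

Definition mt_semiaut : semiaut Sigma := Semiaut mstate_init mtrans_det.

Definition must (Z : {set S}) : {set S} := [set s in Z | must_state s].

Definition AC (Z : {set S}) : {set {set S}} :=
  [set c : {set S} | (c \subset Z) && (must c == must Z)].

Definition AT (Z : {set S}) : {set mstate * Sigma * mstate} :=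
  [set t in mtrans | [exists c1 in AC Z, exists c2 in val t.2 :&: AC Z,
                        (c1, t.1.2, c2) \in Delta A]].

Definition ATf (Z : {set S}) (f : S) : {set mstate * Sigma * mstate} :=
  [set t in AT Z | [exists c : {set S},
                      [&& (f, t.1.2, c) \in vtrans A, f \notin c
                        & c \subset Z]]].

Definition GR (Z : {set S}) : grpair (mstate * Sigma * mstate)%type S :=
  (mtrans :\: AT Z,
   [ffun f => if f \in vacc A :&: Z then Some (ATf Z f) else None]).

Lemma GR_sub p : p \in [set GR Z | Z : {set S}] ->
  gr_K p \subset mtrans
  /\ forall x, x \in gr_dom p -> gr_L p x \subset mtrans.
Proof.
case/imsetP=> Z _ ->; split=> [|f _]; first exact: subsetDl.
rewrite /gr_L ffunE; case: ifP => _ /=; last exact: sub0set.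
by apply/subsetP=> t; rewrite !inE => /andP[/andP[]].
Qed.

Definition mmaa_tgdra : tgdra Sigma := @Tgdra Sigma mt_semiaut S _ GR_sub.

End MmaaToTgdra.

Section TgdraToDra.
Variables (Sigma : finType) (G : tgdra Sigma).
Local Notation trans := (tgdra_trans G).
Local Notation gpair := (grpair trans (tgdra_idx G)).

(* num p lists L_i^1, ..., L_i^{h_i} for the pair p = (K_i, {L_i^j}_j); the
   numbering of the pairs themselves is replaced by indexing with the pairs. *)
Definition numbering (num : gpair -> seq {set trans}) : Prop :=
  forall p, p \in tgdra_acc G ->
    perm_eq (num p) [seq gr_L p x | x <- enum (gr_dom p)].

Variable num : gpair -> seq {set trans}.

Definition acc_pair : finType := {p : gpair | p \in tgdra_acc G}.

Definition dstate : Type :=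
  (sstate G * {dffun forall p : acc_pair, 'I_(gr_size (val p)).+2})%type.

Definition dstate_init : dstate :=
  (sinit G, [ffun p : acc_pair => inord 1 : 'I_(gr_size (val p)).+2]).

Definition Lnum (p : gpair) (j : nat) : {set trans} := nth set0 (num p) j.-1.

(* The counter l' of the pair p after the transition r from counter l. *)
Definition next_level (p : gpair) (r : trans) (l : nat) : nat :=
  let h := gr_size p in
  if r \in gr_K p then 0
  else let lo := if 1 <= l <= h then l else 1 in
    \max_(l' < h.+2 | (lo <= l') &&
       [forall j : 'I_h.+1, (lo <= j < l') ==> (r \in Lnum p j)]) l'.

Definition dstep (q : dstate) (a : Sigma) (q' : dstate) : bool :=
  let r := (q.1, a, q'.1) in
  (r \in strans G) &&
  [forall p : acc_pair, q'.2 p == next_level (val p) r (q.2 p) :> nat].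

Definition dtrans : {set dstate * Sigma * dstate} :=
  [set t | dstep t.1.1 t.1.2 t.2].

Lemma dtrans_det q a q1 q2 :
  (q, a, q1) \in dtrans -> (q, a, q2) \in dtrans -> q1 = q2.
Proof.
case: q1 q2 => [m1 l1] [m2 l2]; rewrite !inE /dstep /=.
move=> /andP[r1 /forallP e1] /andP[r2 /forallP e2].
have em := strans_det r1 r2; rewrite -em in r2 e2 *.
congr (_, _); apply/ffunP => p; apply: val_inj => /=.
by rewrite (eqP (e1 p)) (eqP (e2 p)).
Qed.

Definition tgdra_dra : dra Sigma :=
  @Dra Sigma (Semiaut dstate_init dtrans_det)
    [set ([set q : dstate | q.2 p == 0 :> nat],
          [set q : dstate | q.2 p == (gr_size (val p)).+1 :> nat]) | p : acc_pair].

End TgdraToDra.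

(* Imported only here: classical_sets shadows the finset constants. *)
From mathcomp Require Import all_algebra reals exp.

Local Open Scope ring_scope.

Definition log2 (R : realType) (x : R) : R := ln x / ln 2.

(* Main.v *)
(* The state space of G sits in 2^(2^S), its pairs are indexed by 2^S, and the
   domain of GR_Z is F :&: Z, so everything reduces to |S| <= n; there, counting
   Gs and Fs as two symbols makes the list of subformulae have length exactly n.
   For the asymptotics, the exponent h n = 2^n + 2^(n + log log (n + 2)) equals
   2^n * (1 + log (n + 2)). *)
Require Import Defs.
From mathcomp Require Import all_boot all_order all_algebra.
From mathcomp Require Import reals topology normedtype landau sequences exp.

Set Implicit Arguments.
Unset Strict Implicit.
Unset Printing Implicit Defensive.

Import Order.TTheory GRing.Theory Num.Theory.

Local Open Scope classical_set_scope.
Local Open Scope ring_scope.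

Lemma card_set_type (T : finType) : #|{: {set T}}| = (2 ^ #|T|)%N.
Proof. by rewrite -[in RHS]cardsT -card_powerset powersetT cardsT. Qed.

Lemma size_subf (AP : choiceType) (phi : ltl AP) :
  size (subf phi) = ltl_length phi.
Proof.
by elim: phi => //= [p->|p IHp q IHq|p IHp q IHq|p->|p->|p->|p->] //;
  rewrite size_cat IHp IHq.
Qed.

(** Repeated entries of [s] are identified in [seq_sub s], so only an inequality holds: the
    enumeration is duplicate-free and its values lie in [s]. *)
Lemma card_seq_sub_le (T : choiceType) (s : seq T) :
  (#|{: seq_sub s}| <= size s)%N.
Proof.
rewrite cardE -(size_map val); apply: uniq_leq_size => [|_ /mapP[x _ ->]].
  by rewrite (map_inj_uniq val_inj) enum_uniq.
exact: valP.
Qed.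

Lemma card_formula_mmaa_le (AP : choiceType) (phi : ltl AP) :
  (#|vstate (formula_mmaa phi)| <= ltl_length phi)%N.
Proof.
apply: leq_trans (card_seq_sub_le _) _.
by rewrite size_filter -size_subf count_size.
Qed.

Section MmaaTgdraSize.
Variables (Sigma : finType) (A : mmaa Sigma).

Lemma card_mmaa_tgdra_le :
  (#|sstate (mmaa_tgdra A)| <= 2 ^ (2 ^ #|vstate A|))%N.
Proof.
rewrite card_sig; apply: leq_trans (max_card _) _.
by rewrite !card_set_type.
Qed.

Lemma card_mmaa_tgdra_acc_le :
  (#|tgdra_acc (mmaa_tgdra A)| <= 2 ^ #|vstate A|)%N.
Proof.
by apply: leq_trans (leq_imset_card _ _) _; rewrite card_set_type.
Qed.

Lemma gr_size_GR_le (Z : {set vstate A}) : (gr_size (GR Z) <= #|Z|)%N.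
Proof.
apply/subset_leq_card/subsetP => f; rewrite inE ffunE.
by case: ifP => //; rewrite inE => /andP[].
Qed.

End MmaaTgdraSize.

(** The count is exact because the carrier is the full product, reachable or not, with one
    ordinal-valued counter per pair. *)
Lemma card_tgdra_dra (Sigma : finType) (G : tgdra Sigma)
    (num : grpair (tgdra_trans G) (tgdra_idx G) -> seq {set tgdra_trans G}) :
  #|sstate (tgdra_dra num)| =
    (#|sstate G| * \prod_(p in tgdra_acc G) (gr_size p + 2))%N.
Proof.
rewrite card_prod card_dep_ffun foldrE big_image [in RHS]big_sub.
congr (_ * _)%N.
by apply: eq_bigr => p _; rewrite card_ord addn2.
Qed.

Section Log2.
Variable R : realType.
Implicit Types x y : R.

Lemma ln2_gt0 : 0 < ln (2 : R).
Proof. by rewrite ln_gt0 // ltr1n. Qed.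

Lemma powR_log2 x : 0 < x -> 2 `^ log2 x = x.
Proof.
move=> x0; rewrite /powR pnatr_eq0 /= /log2 divfK ?gt_eqF ?ln2_gt0 //.
by rewrite lnK.
Qed.

Lemma log2_gt0 x : 1 < x -> 0 < log2 x.
Proof. by move=> x1; rewrite divr_gt0 ?ln2_gt0 ?ln_gt0. Qed.

Lemma ler_log2 x y : 0 < x -> x <= y -> log2 x <= log2 y.
Proof.
move=> x0 xy; rewrite ler_pM2r ?invr_gt0 ?ln2_gt0 // ler_ln //.
exact: lt_le_trans xy.
Qed.

Lemma log2_2 : log2 (2 : R) = 1.
Proof. by rewrite /log2 divff // gt_eqF ?ln2_gt0. Qed.

Lemma log2X x n : 0 < x -> log2 (x ^+ n) = n%:R * log2 x.
Proof. by move=> x0; rewrite /log2 lnXn // mulr_natl mulrnAl. Qed.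

(** The hypothesis [1 < x] keeps [log2 x] positive, so the outer logarithm can be undone. This
    removes every iterated logarithm below. *)
Lemma powR_add_loglog (a : nat) x : 1 < x ->
  2 `^ (a%:R + log2 (log2 x)) = 2 ^+ a * log2 x.
Proof.
move=> x1; rewrite powRD ?pnatr_eq0 ?implybT // powR_mulrn //.
by rewrite powR_log2 // log2_gt0.
Qed.

(** For [n >= 2], [n + 2 <= 2 * n <= n ^ 2], so the shift by 2 costs only a factor 2 after taking
    logarithms. *)
Lemma log2_natD2_le (n : nat) : (2 <= n)%N ->
  log2 (n + 2)%:R <= 2 * log2 n%:R :> R.
Proof.
move=> n2; have n0 : 0 < n%:R :> R by rewrite ltr0n (leq_trans _ n2).
rewrite -log2X // ler_log2 ?ltr0n ?addn2 // -natrX ler_nat -addn2 expnS expn1.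
by rewrite (leq_trans _ (leq_mul n2 (leqnn n))) // mul2n -addnn leq_add2l.
Qed.

End Log2.

Theorem mainTheorem2 (R : realType) :
  (forall (AP : choiceType) (phi : ltl AP), pnf phi ->
    let n := ltl_length phi in
    let A := formula_mmaa phi in
    let G := mmaa_tgdra A in
    [/\ (#|vstate A| <= n)%N,
        (#|sstate G| <= 2 ^ (2 ^ n))%N /\ (#|tgdra_acc G| <= 2 ^ n)%N
      & forall num : grpair (tgdra_trans G) (tgdra_idx G)
                       -> seq {set tgdra_trans G},
        numbering num ->
        let D := tgdra_dra num in
        [/\ #|sstate D| =
              (#|sstate G| * \prod_(p in tgdra_acc G) (gr_size p + 2))%N,
            forall Z : {set vstate A},
              (gr_size (GR Z) + 2 <= #|Z| + 2)%N /\ (#|Z| <= n)%N,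
            (#|sstate D| <= 2 ^ (2 ^ n) * (n + 2) ^ (2 ^ n))%N,
            (2 ^ (2 ^ n) * (n + 2) ^ (2 ^ n))%N%:R
              = 2 ^+ (2 ^ n) * 2 `^ (2 ^+ n * log2 (n + 2)%:R) :> R
          & 2 ^+ (2 ^ n) * 2 `^ (2 ^+ n * log2 (n + 2)%:R)
              = 2 ^+ (2 ^ n) * 2 `^ (2 `^ (n%:R + log2 (log2 (n + 2)%:R)))
              :> R]])
  /\
  (exists h : nat -> R^o,
    h =O_\oo (fun n : nat => 2 `^ (n%:R + log2 (log2 n%:R)) : R^o) /\
    forall n : nat,
      2 ^+ (2 ^ n) * 2 `^ (2 `^ (n%:R + log2 (log2 (n + 2)%:R)))
        = 2 `^ h n :> R).
Proof.
(* Even at [n = 0], [log2 (n + 2)] is positive, so its own logarithm is not a default value of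
   [ln]. *)
have n21 n : 1 < (n + 2)%:R :> R by rewrite ltr1n addn2.
split=> [AP phi _ n A G|].
  have leA : (#|vstate A| <= n)%N by exact: card_formula_mmaa_le.
  have leG : (#|sstate G| <= 2 ^ (2 ^ n))%N.
    by apply: leq_trans (card_mmaa_tgdra_le _) _; rewrite !leq_exp2l.
  have leacc : (#|tgdra_acc G| <= 2 ^ n)%N.
    by apply: leq_trans (card_mmaa_tgdra_acc_le _) _; rewrite leq_exp2l.
  split=> // num _ D; split.
  - exact: card_tgdra_dra.
  - move=> Z; split; first by rewrite leq_add2r gr_size_GR_le.
    exact: leq_trans (max_card _) leA.
  - rewrite card_tgdra_dra leq_mul //.
    (* Bound each factor by [n + 2] first, then the number of factors by [2 ^ n]. *)
    apply: (@leq_trans (\prod_(p in tgdra_acc G) (n + 2))%N); last first.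
      by rewrite prod_nat_const leq_exp2l // addn2.
    apply: leq_prod => p /imsetP[Z _ ->]; rewrite leq_add2r.
    by apply: leq_trans (gr_size_GR_le _) (leq_trans (max_card _) leA).
  - rewrite natrM !natrX; congr (_ * _).
    (* Write the base [n + 2] as [2] to the power [log2 (n + 2)]; the remaining real exponent
       [2 ^+ n] is the cast of a natural number. *)
    rewrite mulrC powRrM powR_log2 ?ltr0n ?addn2 //.
    by rewrite -(natrX _ 2) powR_mulrn.
  - by rewrite powR_add_loglog.
exists (fun n : nat => 2 ^+ n + 2 `^ (n%:R + log2 (log2 (n + 2)%:R))).
split; last first.
  move=> n; rewrite [RHS]powRD ?pnatr_eq0 ?implybT //.
  by rewrite -(natrX _ 2 n) powR_mulrn.
(* [log2 (n + 2) <= 2 * log2 n] and [1 <= log2 n] for [n >= 2] give the constant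
   [1 + 2]. *)
apply/eqO_exP; exists 3 => //; exists 2%N => // n /= n2.
have n1 : 1 < n%:R :> R by rewrite ltr1n.
rewrite !ger0_norm ?addr_ge0 ?exprn_ge0 ?powR_ge0 // !powR_add_loglog //.
(* Cancelling [2 ^+ n] leaves [1 + log2 (n + 2) <= 3 * log2 n]. *)
rewrite [leRHS]mulrCA -{1}[2 ^+ n]mulr1 -mulrDr ler_pM2l ?exprn_gt0 //.
rewrite (_ : 3 = 1 + 2) // mulrDl mul1r lerD ?log2_natD2_le //.
by rewrite -[leLHS](log2_2 R) ler_log2 // ler_nat.
Qed.
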